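(* Let $0<L<\infty$, let $f_1(x)=\frac{L}{2}\|x\|^2$ on $\mathbb{R}^n$, let $f_2\in\mathcal{F}_{0,2L}(\mathbb{R}^n)$, and let $f=f_1-f_2$, with $f^\star:=\inf_{x\in\mathbb{R}^n}f(x)$ finite. Let $x^1\in\mathbb{R}^n$ with $f(x^1)>f^\star$, and suppose that $f$ satisfies the Polyak-Łojasiewicz inequality on $X=\{x\in\mathbb{R}^n: f(x)\le f(x^1)\}$ with modulus $\eta$, where $0<\eta\le L$. Put $\kappa=\frac{\eta}{L}$, let \[ \alpha\in\left[0,\ \frac{\sqrt{\kappa^2+2\kappa+4}-\kappa}{2+\kappa}\right], \] and let $x^2$ be obtained from $x^1$ by one iteration of the boosted DCA with boosted step length $\alpha$ applied to the decomposition $f=f_1-f_2$. Then \[ \frac{f(x^2)-f^\star}{f(x^1)-f^\star}\le\beta<1,\qquad\text{where}\qquad \beta:=\kappa\alpha^2-\frac{\kappa(2-2\kappa)}{\kappa+2}\,\alpha+\frac{2-2\kappa}{2+\kappa}. \]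
   Context: For $\mu\in(-\infty,\infty)$ and $0\le M<\infty$, $\mathcal{F}_{\mu,M}(\mathbb{R}^n)$ denotes the class of functions $h:\mathbb{R}^n\to\mathbb{R}$ such that $x\mapsto h(x)-\frac{\mu}{2}\|x\|^2$ and $x\mapsto\frac{M}{2}\|x\|^2-h(x)$ are both convex, where $\|\cdot\|$ is the Euclidean norm. In particular $f_2\in\mathcal{F}_{0,2L}(\mathbb{R}^n)$ is convex and differentiable. A differentiable function $f$ satisfies the Polyak-Łojasiewicz (PŁ) inequality on $X\subseteq\mathbb{R}^n$ with modulus $\eta>0$ if $f(x)-f^\star\le\frac{1}{2\eta}\|\nabla f(x)\|^2$ for all $x\in X$. One iteration of the boosted DCA (difference-of-convex algorithm) with boosted step length $\alpha$ from $x^1$: take $g_2^1\in\partial f_2(x^1)$ (here $g_2^1=\nabla f_2(x^1)$), take $y^1\in\operatorname{argmin}_{x\in\mathbb{R}^n}\, f_1(x)-\left(f_2(x^1)+\langle g_2^1,x-x^1\rangle\right)$, and set $x^2=y^1+\alpha(y^1-x^1)$. *)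

(* Defs.v *)
From HB Require Import structures.
From mathcomp Require Import all_boot all_order all_algebra.
From mathcomp Require Import all_classical all_reals all_analysis.

Set Implicit Arguments.
Unset Strict Implicit.
Unset Printing Implicit Defensive.

Import Order.TTheory GRing.Theory Num.Theory.
Import numFieldNormedType.Exports.

Local Open Scope classical_set_scope.
Local Open Scope ring_scope.

Definition dotrv (R : realType) (n : nat) (u v : 'rV[R]_n) : R :=
  \sum_(i < n) u ord0 i * v ord0 i.

(* The library norm `|x| on 'rV[R]_n is the sup norm, hence this definition. *)
Definition enorm (R : realType) (n : nat) (x : 'rV[R]_n) : R :=
  Num.sqrt (dotrv x x).

(* Partial derivatives do not depend on the choice of a norm on 'rV[R]_n. *)
Definition gradient (R : realType) (n : nat) (f : 'rV[R]_n -> R)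
    (x : 'rV[R]_n) : 'rV[R]_n :=
  \row_(i < n) 'D_(delta_mx ord0 i) f x.

Definition curvature_class (R : realType) (n : nat) (mu M : R)
    : set ('rV[R]_n -> R) :=
  [set h | convex_function [set: 'rV[R]_n]
             (fun x => h x - mu / 2 * enorm x ^+ 2) /\
           convex_function [set: 'rV[R]_n]
             (fun x => M / 2 * enorm x ^+ 2 - h x)].

Definition subdifferential (R : realType) (n : nat) (h : 'rV[R]_n -> R)
    (x : 'rV[R]_n) : set 'rV[R]_n :=
  [set g | forall y, h x + dotrv g (y - x) <= h y].

Definition argmin (R : realType) (T : Type) (h : T -> R) : set T :=
  [set y | forall x, h y <= h x].

(* The infimum is over the whole space, not over X.  Differentiability of f is
   not part of the predicate, which is meaningful only where f is
   differentiable; L/2 ||x||^2 - h is differentiable for every h in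
   curvature_class 0 (2 L). *)
Definition polyak_lojasiewicz (R : realType) (n : nat) (f : 'rV[R]_n -> R)
    (X : set 'rV[R]_n) (eta : R) : Prop :=
  forall x, X x ->
    f x - inf (range f) <= 1 / (2 * eta) * enorm (gradient f x) ^+ 2.

Definition boosted_dca_step (R : realType) (n : nat)
    (f1 f2 : 'rV[R]_n -> R) (alpha : R) (x1 x2 : 'rV[R]_n) : Prop :=
  exists g2 y1 : 'rV[R]_n,
    [/\ subdifferential f2 x1 g2,
        argmin (fun x => f1 x - (f2 x1 + dotrv g2 (x - x1))) y1 &
        x2 = y1 + alpha *: (y1 - x1)].

(* Main.v *)
(* Scale to L = 1, so that f is 1-smooth, y = x1 - g1 and x2 = y - alpha g1,
   with g1 and gy the gradients of f at x1 and y.  Write A, E, B for f - fstar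
   at x1, y, x2, and a = |g1|^2, b = |gy|^2, c = <gy, g1>.  The interpolation
   inequalities for the convex, 2-smooth f2 give, both ways between x1 and y,
     E <= A - a/2 - b/4   and   A - E - a/2 + b/4 <= c,
   and convexity of f2 gives B <= E - alpha c + alpha^2 a/2.  A nonnegative
   combination of these three with the PL inequalities at x1 and y, that is
   2 kappa A <= a and 2 kappa E <= b, is B <= beta A; the PL inequality is not
   used at x2.  Applying it at y requires an actual gradient there, hence a
   subgradient of f2 at y, whose existence is derived from the curvature
   bounds. *)
Require Import Defs.
From HB Require Import structures.
From mathcomp Require Import all_boot all_order all_algebra.
From mathcomp Require Import all_classical all_reals all_analysis.
From mathcomp Require Import ring lra.

Set Implicit Arguments.
Unset Strict Implicit.
Unset Printing Implicit Defensive.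

Import Order.TTheory GRing.Theory Num.Theory.
Import numFieldNormedType.Exports.

Local Open Scope classical_set_scope.
Local Open Scope ring_scope.

(** * Euclidean inner product on row vectors *)

Lemma dotrvC (R : realType) (n : nat) (u v : 'rV[R]_n) :
  dotrv u v = dotrv v u.
Proof. by apply: eq_bigr => i _; rewrite mulrC. Qed.

Lemma dotrvDl (R : realType) (n : nat) (u v w : 'rV[R]_n) :
  dotrv (u + v) w = dotrv u w + dotrv v w.
Proof. by rewrite -big_split; apply: eq_bigr => i _; rewrite mxE mulrDl. Qed.

Lemma dotrvZl (R : realType) (n : nat) (a : R) (u v : 'rV[R]_n) :
  dotrv (a *: u) v = a * dotrv u v.
Proof. by rewrite [RHS]mulr_sumr; apply: eq_bigr => i _; rewrite mxE mulrA. Qed.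

Lemma dotrvNl (R : realType) (n : nat) (u v : 'rV[R]_n) :
  dotrv (- u) v = - dotrv u v.
Proof. by rewrite -scaleN1r dotrvZl mulN1r. Qed.

Lemma dotrvDr (R : realType) (n : nat) (u v w : 'rV[R]_n) :
  dotrv w (u + v) = dotrv w u + dotrv w v.
Proof. by rewrite dotrvC dotrvDl !(dotrvC _ w). Qed.

Lemma dotrvZr (R : realType) (n : nat) (a : R) (u v : 'rV[R]_n) :
  dotrv u (a *: v) = a * dotrv u v.
Proof. by rewrite dotrvC dotrvZl dotrvC. Qed.

Lemma dotrvNr (R : realType) (n : nat) (u v : 'rV[R]_n) :
  dotrv u (- v) = - dotrv u v.
Proof. by rewrite dotrvC dotrvNl dotrvC. Qed.

Definition dotrvE := (dotrvDl, dotrvDr, dotrvNl, dotrvNr, dotrvZl, dotrvZr).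

Lemma dotrv_ge0 (R : realType) (n : nat) (u : 'rV[R]_n) : 0 <= dotrv u u.
Proof. by apply: sumr_ge0 => i _; rewrite -expr2 sqr_ge0. Qed.

Lemma dotrv_le0_eq0 (R : realType) (n : nat) (u : 'rV[R]_n) :
  dotrv u u <= 0 -> u = 0.
Proof.
move=> u_le0; have /eqP : dotrv u u = 0 by apply/le_anti; rewrite u_le0 dotrv_ge0.
rewrite psumr_eq0 => [/allP u0|i _]; last by rewrite -expr2 sqr_ge0.
apply/rowP => i; have := u0 i (mem_index_enum i).
by rewrite /= mulf_eq0 orbb mxE => /eqP.
Qed.

Lemma sqr_enorm (R : realType) (n : nat) (u : 'rV[R]_n) :
  enorm u ^+ 2 = dotrv u u.
Proof. by rewrite sqr_sqrtr ?dotrv_ge0. Qed.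

Lemma dotrv_delta (R : realType) (n : nat) (u : 'rV[R]_n) (i : 'I_n) :
  dotrv u (delta_mx ord0 i) = u ord0 i.
Proof.
rewrite /dotrv (bigD1 i) //= big1 => [|j ji]; first by rewrite mxE !eqxx mulr1 addr0.
by rewrite mxE (negPf ji) andbF mulr0.
Qed.

(** * Subgradients, quadratic majorants and interpolation from the curvature bounds *)

Lemma convex_functionT_le (R : realType) (n : nat) (h : 'rV[R]_n -> R) :
  convex_function [set: 'rV[R]_n] h ->
  forall (t : R) (x y : 'rV[R]_n), 0 <= t <= 1 ->
    h (t *: x + (1 - t) *: y) <= t * h x + (1 - t) * h y.
Proof.
move=> hc t x y /andP[t0 t1].
by have /= := hc (Itv01 t0 t1) x y (in_setT _) (in_setT _).
Qed.

Section curvature_class0.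
Variables (R : realType) (n : nat) (M : R) (h : 'rV[R]_n -> R).
Hypothesis hM : curvature_class 0 M h.

Lemma curvature_class0_convex (t : R) (x y : 'rV[R]_n) : 0 <= t <= 1 ->
  h (t *: x + (1 - t) *: y) <= t * h x + (1 - t) * h y.
Proof.
case: hM => hc _ t01; have := convex_functionT_le hc x y t01.
by rewrite !mul0r !subr0.
Qed.

(** The convexity gap of [|.|^2] is exactly [t * (1 - t) * |x - y|^2]. *)
Lemma curvature_class0_smooth (t : R) (x y : 'rV[R]_n) : 0 <= t <= 1 ->
  t * h x + (1 - t) * h y - M / 2 * (t * (1 - t)) * dotrv (x - y) (x - y)
  <= h (t *: x + (1 - t) *: y).
Proof.
case: hM => _ hs t01; have := convex_functionT_le hs x y t01.
rewrite !sqr_enorm !dotrvE (dotrvC y x) => hxy.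
rewrite -subr_ge0; rewrite -subr_ge0 in hxy; apply: le_trans hxy _.
by rewrite le_eqVlt; apply/predU1l; field.
Qed.

(** By convexity every backward difference quotient is at most every forward one, so the infimum of
    the forward quotients supports [h] for both signs of [t]. *)
Lemma curvature_class0_line_subgradient (x v : 'rV[R]_n) :
  exists g : R, forall t, h x + t * g <= h (x + t *: v).
Proof.
pose S := [set (h (x + t *: v) - h x) / t | t in [set t | 0 < t]].
have lbS r : 0 < r -> lbound S ((h x - h (x - r *: v)) / r).
  move=> r0 _ [t /= t0 <-].
  have rt0 : 0 < r + t by rewrite addr_gt0.
  have t01 : 0 <= r / (r + t) <= 1.
    by rewrite ler_pdivrMr// ler_pdivlMr// mul0r mul1r lerDl !ltW.
  have := curvature_class0_convex (x + t *: v) (x - r *: v) t01.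
  have -> : r / (r + t) *: (x + t *: v) + (1 - r / (r + t)) *: (x - r *: v) = x.
    by apply/rowP => i; rewrite !mxE; field; rewrite gt_eqF.
  have -> : 1 - r / (r + t) = t / (r + t) by field; rewrite gt_eqF.
  rewrite ![_ / _ * _]mulrAC -mulrDl ler_pdivlMr// => hx.
  rewrite ler_pdivrMr// mulrAC ler_pdivlMr//; lra.
have S0 : S !=set0 by exists ((h (x + 1 *: v) - h x) / 1), 1 => //=.
have hlbS : has_lbound S by exists ((h x - h (x - 1 *: v)) / 1); exact: lbS.
exists (inf S) => t; have [t0|t0|->] := ltgtP t 0.
- have := lb_le_inf S0 (lbS (- t) _); rewrite oppr_gt0 => /(_ t0).
  by rewrite scaleNr opprK ler_pdivrMr ?oppr_gt0//; lra.
- have : inf S <= (h (x + t *: v) - h x) / t by apply: ge_inf => //; exists t.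
  by rewrite ler_pdivlMr//; lra.
- by rewrite mul0r scale0r !addr0.
Qed.

(* Directional linear minorants of [h] at [x], up to a quadratic error, add up:
   the convexity of [M / 2 |.|^2 - h] bounds [h] at a midpoint from below. *)
Lemma curvature_class0_subdifferential (x : 'rV[R]_n) :
  exists g, subdifferential h x g.
Proof.
have [g gP] := choice (fun i =>
  curvature_class0_line_subgradient x (delta_mx ord0 i)).
exists (\row_i g i) => y.
pose P (v : 'rV[R]_n) (a : R) :=
  exists C, forall s, h x + s * a - C * s ^+ 2 <= h (x + s *: v).
have [C CP] : P (\sum_i (y - x) ord0 i *: delta_mx ord0 i)
                (\sum_i (\row_i g i) ord0 i * (y - x) ord0 i).
  apply: (big_ind2 P).
  - by exists 0 => s; rewrite mulr0 mul0r scaler0 subr0 !addr0.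
  - move=> u a w b [C CP] [D DP].
    (* Step [2 * s] along [u] and [w] quadruples the errors, and the midpoint halves them; the last
       term is the curvature gap. *)
    exists (2 * C + 2 * D + M / 2 * dotrv (u - w) (u - w)) => s.
    have h01 : 0 <= (2^-1 : R) <= 1 by apply/andP; split; lra.
    have := curvature_class0_smooth (x + (2 * s) *: u) (x + (2 * s) *: w) h01.
    have -> : 2^-1 *: (x + (2 * s) *: u) + (1 - 2^-1) *: (x + (2 * s) *: w)
              = x + s *: (u + w) by apply/rowP => i; rewrite !mxE; field.
    apply: le_trans.
    have -> : x + (2 * s) *: u - (x + (2 * s) *: w) = (2 * s) *: (u - w).
      by apply/rowP => i; rewrite !mxE; ring.
    rewrite dotrvZl dotrvZr.
    have := CP (2 * s); have := DP (2 * s); lra.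
  - move=> i _; exists 0 => s.
    rewrite mul0r subr0 scalerA mxE [g i * _]mulrC mulrA; exact: gP.
rewrite -row_sum_delta in CP.
rewrite -/(dotrv _ _) in CP.
set a := dotrv _ _ in CP *.
(* Convexity along the segment from [x] to [y], divided by [s], turns the quadratic error into a
   linear one, which vanishes as [s] tends to 0. *)
have Cs s : 0 < s <= 1 -> h x + a - C * s <= h y.
  move=> /andP[s0 s1].
  have s01 : 0 <= s <= 1 by rewrite (ltW s0).
  have := curvature_class0_convex y x s01.
  have -> : s *: y + (1 - s) *: x = x + s *: (y - x).
    by apply/rowP => i; rewrite !mxE; ring.
  move/(le_trans (CP s)) => hs.
  by rewrite -(ler_pM2l s0); lra.
apply/ler_addgt0Pr => e e0.
pose s := Num.min 1 (e / (`|C| + 1)).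
have C0 : 0 < `|C| + 1 by rewrite ltr_wpDl.
have s0 : 0 < s by rewrite lt_min ltr01 divr_gt0.
have s1 : s <= 1 by rewrite ge_min lexx.
have se : s * (`|C| + 1) <= e by rewrite -ler_pdivlMr// ge_min lexx orbT.
have : C * s <= `|C| * s by rewrite ler_pM2r// ler_norm.
have := Cs s; rewrite s0 s1 => /(_ isT); lra.
Qed.

(** [x] lies between [y] and [x - s *: v]. The curvature bound at [x] and the linear minorant at
    [x - s *: v] give the claim up to a factor [1 + s] on the quadratic term; then [s] tends to
    0. *)
Lemma curvature_class0_le (x g y : 'rV[R]_n) : subdifferential h x g ->
  h y <= h x + dotrv g (y - x) + M / 2 * dotrv (y - x) (y - x).
Proof.
move=> gx.
set v := y - x.
have Cs s : 0 < s -> h y <= h x + dotrv g v + M / 2 * (1 + s) * dotrv v v.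
  move=> s0.
  have s10 : 0 < 1 + s by lra.
  have s01 : 0 <= s / (1 + s) <= 1.
    by rewrite ler_pdivrMr// ler_pdivlMr// mul0r mul1r lerDr ler01 ltW.
  have := curvature_class0_smooth y (x - s *: v) s01.
  have -> : s / (1 + s) *: y + (1 - s / (1 + s)) *: (x - s *: v) = x.
    by apply/rowP => i; rewrite !mxE; field; rewrite gt_eqF.
  have -> : y - (x - s *: v) = (1 + s) *: v.
    by apply/rowP => i; rewrite !mxE; ring.
  have := gx (x - s *: v).
  rewrite [x - _ - x]addrAC subrr add0r dotrvNr !dotrvZr dotrvZl => h1 h2.
  have {}h2 : s * h y + h (x - s *: v) - M / 2 * s * (1 + s) * dotrv v v <= (1 + s) * h x.
    rewrite -(ler_pM2l s10) in h2; apply: le_trans h2.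
    by rewrite le_eqVlt; apply/predU1l; field; rewrite gt_eqF.
  by rewrite -(ler_pM2l s0); lra.
apply/ler_addgt0Pr => e e0.
pose K := M / 2 * dotrv v v.
have K0 : 0 < `|K| + 1 by rewrite ltr_wpDl.
have s0 : 0 < e / (`|K| + 1) by rewrite divr_gt0.
apply: le_trans (Cs _ s0) _.
set s := e / _ in s0 *.
have se : s * (`|K| + 1) = e by rewrite mulfVK// gt_eqF.
have : K * s <= `|K| * s by rewrite ler_pM2r// ler_norm.
rewrite /K; rewrite /K in se; lra.
Qed.

(* Compares the minorant at [x] and the majorant at [y] at the minimiser
   [y - (gy - gx) / M] of their difference. *)
Lemma curvature_class0_interpolation (x gx y gy : 'rV[R]_n) : 0 < M ->
  subdifferential h x gx -> subdifferential h y gy ->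
  h x + dotrv gx (y - x) + 1 / (2 * M) * dotrv (gy - gx) (gy - gx) <= h y.
Proof.
move=> M0 hx hy.
pose z := y - M^-1 *: (gy - gx).
have := le_trans (hx z) (curvature_class0_le z hy).
have -> : z - x = (y - x) - M^-1 *: (gy - gx) by rewrite /z addrAC.
have -> : z - y = - (M^-1 *: (gy - gx)) by rewrite /z addrAC subrr add0r.
move=> hz; rewrite -subr_ge0; rewrite -subr_ge0 in hz; apply: le_trans hz _.
rewrite !dotrvE (dotrvC gx gy).
by rewrite le_eqVlt; apply/predU1l; field; rewrite gt_eqF.
Qed.

End curvature_class0.

(** * Gradient of the objective and the minimiser of the DCA subproblem *)

Lemma derive_quadratic_error (R : realType) (n : nat) (f : 'rV[R]_n -> R)
    (x v : 'rV[R]_n) (a C : R) :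
  (forall t, `|f (x + t *: v) - f x - t * a| <= C * t ^+ 2) -> 'D_v f x = a.
Proof.
move=> fa; apply/cvg_lim => //.
apply/cvgrPdist_le => e e0.
have C0 : 0 <= C by have := fa 1; rewrite expr1n mulr1; exact: le_trans.
have C10 : 0 < C + 1 by rewrite ltr_wpDl.
near=> t.
have t0 : t != 0 by near: t; exact: nbhs_dnbhs_neq.
have te : `|t| <= e / (C + 1).
  by near: t; apply: dnbhs0_le; rewrite divr_gt0.
rewrite /= /shift /= [t *: v + x]addrC.
have -> : a - t^-1 *: (f (x + t *: v) - f x)
          = - (t^-1 * (f (x + t *: v) - f x - t * a)).
  by rewrite /GRing.scale /=; field.
rewrite normrN normrM normfV ler_pdivrMl ?normr_gt0//.
apply: le_trans (fa t) _.
rewrite -real_normK ?num_real// expr2 mulrCA ler_wpM2l//.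
rewrite ler_pdivlMr// in te; apply: le_trans te.
by rewrite mulrC ler_wpM2l// lerDl.
Unshelve. all: by end_near. Qed.

(** The remainder of [h] along [t *: v] lies between 0 and [L * t ^+ 2 * |v|^2]; subtracting it from
    half that bound leaves an error of absolute value at most [L / 2 * t ^+ 2 * |v|^2]. *)
Lemma gradient_quadraticB (R : realType) (n : nat) (L : R)
    (h : 'rV[R]_n -> R) (x g : 'rV[R]_n) :
  curvature_class 0 (2 * L) h -> subdifferential h x g ->
  gradient (fun z => L / 2 * enorm z ^+ 2 - h z) x = L *: x - g.
Proof.
move=> hL hx; apply/rowP => i; rewrite mxE -[RHS]dotrv_delta.
set v := delta_mx ord0 i.
apply: (@derive_quadratic_error _ _ _ _ _ _ (L / 2 * dotrv v v)) => t.
have hl := hx (x + t *: v).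
have := curvature_class0_le hL (x + t *: v) hx.
rewrite [x + _]addrC addrK in hl *; rewrite !sqr_enorm !dotrvE (dotrvC v x).
rewrite !dotrvE in hl.
by move=> hu; rewrite ler_norml; apply/andP; split; lra.
Qed.

Lemma argmin_quadraticB (R : realType) (n : nat) (L c : R)
    (x1 g y : 'rV[R]_n) : 0 < L ->
  argmin (fun x => L / 2 * enorm x ^+ 2 - (c + dotrv g (x - x1))) y ->
  g = L *: y.
Proof.
(* The objective at [y] exceeds its value at [L^-1 *: g] by [|L *: y - g|^2 / (2 * L)]. *)
move=> L0 /(_ (L^-1 *: g)); rewrite !sqr_enorm => hy.
apply/esym/subr0_eq/dotrv_le0_eq0.
have L20 : 0 < L^-1 / 2 by rewrite divr_gt0// invr_gt0.
rewrite -(pmulr_rle0 _ L20).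
rewrite -subr_le0 in hy; apply: le_trans hy.
rewrite !dotrvE (dotrvC g y) le_eqVlt; apply/predU1l; field.
by rewrite gt_eqF.
Qed.

(** * Scalar inequalities for the step length and the rate *)

Lemma boosted_step_quadratic_bound (R : realType) (kappa alpha : R) : 0 < kappa ->
  0 <= alpha <= (Num.sqrt (kappa ^+ 2 + 2 * kappa + 4) - kappa) / (2 + kappa) ->
  (2 + kappa) * alpha ^+ 2 + 2 * kappa * alpha <= 2.
Proof.
move=> k0 /andP[a0]; have k20 : 0 < 2 + kappa by rewrite addr_gt0.
rewrite ler_pdivlMr// lerBrDr => ha.
have d0 : 0 <= kappa ^+ 2 + 2 * kappa + 4 by have := sqr_ge0 kappa; lra.
have l0 : 0 <= alpha * (2 + kappa) + kappa by rewrite addr_ge0 ?mulr_ge0// ltW.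
have : (alpha * (2 + kappa) + kappa) ^+ 2 <= kappa ^+ 2 + 2 * kappa + 4.
  by rewrite -(sqr_sqrtr d0) ler_pXn2r// nnegrE sqrtr_ge0.
by move=> h; rewrite -(ler_pM2l k20); lra.
Qed.

(* The weights are chosen so that the terms in [E] cancel; the constraint on
   [alpha] says exactly that the resulting coefficient of [a] is nonpositive. *)
Lemma boosted_rate_le (R : realType) (kappa alpha A E B a b c : R) :
  0 < kappa <= 1 -> 0 <= alpha ->
  (2 + kappa) * alpha ^+ 2 + 2 * kappa * alpha <= 2 ->
  2 * kappa * A <= a -> 2 * kappa * E <= b ->
  E <= A - a / 2 - b / 4 ->
  A - E - a / 2 + b / 4 <= c ->
  B <= E - alpha * c + alpha ^+ 2 * a / 2 ->
  B <= (kappa * alpha ^+ 2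
        - kappa * (2 - 2 * kappa) / (kappa + 2) * alpha
        + (2 - 2 * kappa) / (2 + kappa)) * A.
Proof.
move=> /andP[k0 k1] a0 arange plA plE hE hc hB.
have k20 : 0 < 2 + kappa by rewrite addr_gt0.
(* With weights [2 + kappa] on [hB] and [(2 + kappa) * alpha] on [hc], this multiplier of [hE] is
   the one that cancels [E] after [b] is replaced by [2 * kappa * E]. *)
pose w := 2 + 2 * alpha - kappa * alpha.
have w0 : 0 <= w.
  have : kappa * alpha <= alpha by rewrite ler_piMl.
  rewrite /w; lra.
have wa0 : 0 <= w - (2 + kappa) * (alpha + alpha ^+ 2) by rewrite /w; lra.
have hE' := ler_wpM2l w0 hE.
have hc' := ler_wpM2l (mulr_ge0 (ltW k20) a0) hc.
have hB' := ler_wpM2l (ltW k20) hB.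
have hA' := ler_wpM2l wa0 plA.
have hb' : ((2 + kappa) * alpha + w) * (2 * kappa * E)
           <= ((2 + kappa) * alpha + w) * b.
  by rewrite ler_wpM2l// addr_ge0// mulr_ge0// ltW.
rewrite -(ler_pM2l k20).
have -> : (2 + kappa) * ((kappa * alpha ^+ 2
        - kappa * (2 - 2 * kappa) / (kappa + 2) * alpha
        + (2 - 2 * kappa) / (2 + kappa)) * A)
  = ((2 + kappa) * kappa * alpha ^+ 2 - kappa * (2 - 2 * kappa) * alpha
        + (2 - 2 * kappa)) * A.
  by field; rewrite gt_eqF// addrC gt_eqF.
rewrite /w in hE' hA' hb'; lra.
Qed.

(** Adding [kappa] times the range inequality bounds [2 + kappa] times the rate by
    [2 - 2 * kappa * alpha]. *)
Lemma boosted_rate_lt1 (R : realType) (kappa alpha : R) :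
  0 < kappa <= 1 -> 0 <= alpha ->
  (2 + kappa) * alpha ^+ 2 + 2 * kappa * alpha <= 2 ->
  kappa * alpha ^+ 2 - kappa * (2 - 2 * kappa) / (kappa + 2) * alpha
    + (2 - 2 * kappa) / (2 + kappa) < 1.
Proof.
move=> /andP[k0 k1] a0 arange.
have k20 : 0 < 2 + kappa by rewrite addr_gt0.
rewrite -(ltr_pM2l k20).
have -> : (2 + kappa) * (kappa * alpha ^+ 2
        - kappa * (2 - 2 * kappa) / (kappa + 2) * alpha
        + (2 - 2 * kappa) / (2 + kappa))
  = kappa * ((2 + kappa) * alpha ^+ 2) - kappa * (2 - 2 * kappa) * alpha
        + (2 - 2 * kappa).
  by field; rewrite gt_eqF// addrC gt_eqF.
have := ler_wpM2l (ltW k0) arange.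
have := mulr_ge0 (ltW k0) a0; lra.
Qed.

(** * Contraction of the objective gap in one boosted step *)

Theorem theorem4 (R : realType) (n : nat) (L eta alpha : R)
    (f2 : 'rV[R]_n -> R) (x1 x2 : 'rV[R]_n) :
  let f1 := fun x : 'rV[R]_n => L / 2 * enorm x ^+ 2 in
  let f := fun x : 'rV[R]_n => f1 x - f2 x in
  let fstar := inf (range f) in
  let kappa := eta / L in
  let beta := kappa * alpha ^+ 2
              - kappa * (2 - 2 * kappa) / (kappa + 2) * alpha
              + (2 - 2 * kappa) / (2 + kappa) in
  0 < L ->
  curvature_class 0 (2 * L) f2 ->
  has_lbound (range f) ->
  fstar < f x1 ->
  0 < eta <= L ->
  polyak_lojasiewicz f [set x | f x <= f x1] eta ->
  0 <= alpha <= (Num.sqrt (kappa ^+ 2 + 2 * kappa + 4) - kappa) / (2 + kappa) ->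
  boosted_dca_step f1 f2 alpha x1 x2 ->
  (f x2 - fstar) / (f x1 - fstar) <= beta /\ beta < 1.
Proof.
move=> f1 f fstar kappa beta L0 hf2 _ fx1 /andP[eta0 etaL] PL ha.
case=> s1 [y [hs1 /(argmin_quadraticB L0) s1E x2E]].
have L20 : 0 < 2 * L by rewrite mulr_gt0.
have Ln0 : L != 0 by rewrite gt_eqF.
have k0 : 0 < kappa by rewrite divr_gt0.
have k01 : 0 < kappa <= 1 by rewrite k0 ler_pdivrMr// mul1r.
have /andP[a0 _] := ha.
have arange := boosted_step_quadratic_bound k0 ha.
split; last exact: boosted_rate_lt1.
have [sy hsy] := curvature_class0_subdifferential hf2 y.
have PLx x g : subdifferential f2 x g -> f x <= f x1 ->
    2 * kappa * (f x - fstar) <= L^-1 * dotrv (L *: x - g) (L *: x - g).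
  move=> hx fx; have := PL x fx.
  rewrite (gradient_quadraticB hf2 hx) sqr_enorm => h.
  have e20 : 0 < 2 * kappa by rewrite mulr_gt0.
  rewrite -(ler_pM2l e20) in h; apply: le_trans h _.
  by rewrite le_eqVlt /kappa; apply/predU1l; field; rewrite Ln0 gt_eqF.
(* Since [s1 = L *: y], the gradients of [f] at [x1] and [y] are [L *: d] and [e]; the scalars [a],
   [b], [c] become [L * |d|^2], [L^-1 * |e|^2] and [dotrv e d]. *)
pose d := x1 - y; pose e := L *: y - sy.
have x1E : x1 = y + d by rewrite /d addrC subrK.
have {}x2E : x2 = y - alpha *: d.
  by rewrite x2E -(opprB x1) scalerN.
have syE : sy = L *: y - e by rewrite /e subKr.
have plA := PLx _ _ hs1 (lexx _).
have plE := PLx _ _ hsy.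
have I1 := curvature_class0_interpolation hf2 L20 hs1 hsy.
have I2 := curvature_class0_interpolation hf2 L20 hsy hs1.
have I3 := hsy x2.
rewrite -/e in plE.
have dL : L *: x1 - s1 = L *: d by rewrite s1E scalerBr.
rewrite dL dotrvZl dotrvZr mulKf// in plA.
have ss : sy - s1 = - e by rewrite s1E /e opprB.
have ss' : s1 - sy = e by rewrite s1E.
have yx1 : y - x1 = - d by rewrite /d opprB.
have x2y : x2 - y = - (alpha *: d) by rewrite x2E addrAC subrr add0r.
rewrite ss yx1 s1E dotrvNl 2!dotrvNr opprK in I1.
rewrite ss' -/d syE dotrvDl dotrvNl in I2.
rewrite x2y syE dotrvDl dotrvNl !dotrvNr !dotrvZr in I3.
rewrite ?dotrvZl in I1 I2 I3.
clearbody d e.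
have fx1E : f x1 = L / 2 * (dotrv y y + 2 * dotrv y d + dotrv d d) - f2 x1.
  by rewrite /f /f1 sqr_enorm {1 2}x1E !dotrvE (dotrvC d y); ring.
have fyE : f y = L / 2 * dotrv y y - f2 y by rewrite /f /f1 sqr_enorm.
have fx2E : f x2 = L / 2 * (dotrv y y - 2 * alpha * dotrv y d
    + alpha ^+ 2 * dotrv d d) - f2 x2.
  by rewrite /f /f1 sqr_enorm {1 2}x2E !dotrvE (dotrvC d y); ring.
have eeE : 1 / (2 * (2 * L)) * dotrv e e = L^-1 * dotrv e e / 4 by field.
rewrite eeE in I1 I2.
have b0 : 0 <= L^-1 * dotrv e e by rewrite mulr_ge0 ?dotrv_ge0// invr_ge0 ltW.
have a'0 : 0 <= L * dotrv d d by rewrite mulr_ge0 ?dotrv_ge0// ltW.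
(* This also gives [f y <= f x1], so that the PL inequality may be applied at [y]. *)
have hE : f y - fstar <= f x1 - fstar - L * dotrv d d / 2 - L^-1 * dotrv e e / 4.
  by rewrite fx1E fyE; lra.
rewrite ler_pdivrMr ?subr_gt0//.
apply: (boosted_rate_le (c := dotrv e d) k01 a0 arange plA (plE _) hE).
- lra.
- by rewrite fx1E fyE; lra.
- by rewrite fyE fx2E; lra.
Qed.
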